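(* Let $\Bbbk$ be a field, $n\ge 1$, and $w\in\mathfrak{S}_n$. The Schubert determinantal ideal $I_w\subset R=\Bbbk[x_{ij}]_{1\le i,j\le n}$ is minimally generated by the elusive minors of $I_w$; that is, the set of elusive minors generates $I_w$ and no proper subset of it generates $I_w$. Moreover, for any $b\in D(w)$ there exists an elusive minor whose southeast corner is $b$.
   Context: Notation: $[n]=\{1,\dots,n\}$; $w$ is a permutation in the symmetric group $\mathfrak{S}_n$ on $[n]$; $M_w$ is its permutation matrix with $1$ in position $(i,w(i))$ and $0$ elsewhere. $M=(x_{ij})_{1\le i,j\le n}$ is the generic $n\times n$ matrix (rows numbered top to bottom, columns left to right) and $R=\Bbbk[x_{ij}]_{1\le i,j\le n}$ is the coordinate ring of the space ${\sf Mat}_{n\times n}$ of $n\times n$ matrices over $\Bbbk$. $M^{[i,j]}$ is the northwest $i\times j$ submatrix of $M$. Rank function: $r_{i,j}=r_{i,j}(w)=\#\{k\le i: w(k)\le j\}$, the number of $1$'s of $M_w$ weakly northwest of $(i,j)$. Rothe diagram: $D(w)=\{(i,j)\in[n]^2: j<w(i),\ i<w^{-1}(j)\}$. Fulton's essential set: $E(w)=\{(i,j)\in D(w): (i+1,j)\notin D(w),\ (i,j+1)\notin D(w)\}$. Matrix Schubert variety and Schubert determinantal ideal: let $B$, $B_-\subset GL_n$ be the subgroups of upper, respectively lower, triangular matrices, with $B_-\times B$ acting on ${\sf Mat}_{n\times n}$ by $(b_-,b)\cdot Z=b_-Zb^{-1}$. $X_w$ is the closure of the orbit of $M_w$, and $I_w\subset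 R$ is its defining ideal. By Fulton, $I_w$ is the (prime) ideal generated by all $(r_{i,j}+1)\times(r_{i,j}+1)$ minors of $M^{[i,j]}$ for $(i,j)\in[n]^2$, and equivalently by those with $(i,j)\in E(w)$; over an arbitrary field $\Bbbk$ this determinantal description is to be taken as the definition of $I_w$. Minors: for $I,J\subseteq[n]$ with $|I|=|J|\geq 1$, $m_{I,J}$ is the determinant of the submatrix of $M$ with row set $I$ and column set $J$. Its southeast corner is $(\max I,\max J)$. The minor $m_{I,J}$ belongs to $(i,j)\in E(w)$ if $I\subseteq[i]$, $J\subseteq[j]$ and $|I|=|J|=r_{i,j}+1$. Minors belonging to some element of $E(w)$ are the essential minors of $I_w$. A minor $m_{I,J}$ belonging to $(i,j)\in E(w)$ attends $M^{[i',j']}$ if either ($|I\cap[i']|>r_{i',j'}$ and $|J\cap[j']|=r_{i,j}+1$) or ($|I\cap[i']|=r_{i,j}+1$ and $|J\cap[j']|>r_{i',j'}$). A minor $m_{I,J}$ belonging to $(i,j)\in E(w)$ is elusive if it does not attend $M^{[i',j']}$ for any $(i',j')\in E(w)$ with $r_{i',j'}<r_{i,j}$. *)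

(* Defs.v *)
From HB Require Import structures.
From mathcomp Require Import all_boot all_order all_algebra all_fingroup.
From mathcomp Require Import mpoly.

Set Implicit Arguments.
Unset Strict Implicit.
Unset Printing Implicit Defensive.

Import GRing.Theory.
Local Open Scope ring_scope.

(* Rows and columns are numbered from 0: the position (i, j) of 'I_n * 'I_n
   stands for (i + 1, j + 1) in [n]^2. *)

Section Ideals.
Variable A : comNzRingType.

Definition ideal_gen (G : A -> Prop) (p : A) : Prop :=
  exists2 s : seq (A * A),
    (forall c, c \in s -> G c.2) & p = \sum_(c <- s) c.1 * c.2.

Definition generates (G : A -> Prop) (I : A -> Prop) : Prop :=
  forall p, ideal_gen G p <-> I p.

Definition proper_subset (S G : A -> Prop) : Prop :=
  (forall p, S p -> G p) /\ (exists p, G p /\ ~ S p).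

Definition minimally_generates (G : A -> Prop) (I : A -> Prop) : Prop :=
  generates G I /\ (forall S, proper_subset S G -> ~ generates S I).
End Ideals.

Section Permutation.
Variables (n : nat) (w : 'S_n).

(* [i + 1] = {1, ..., i + 1} in 1-based numbering *)
Definition initial (i : 'I_n) : {set 'I_n} := [set k : 'I_n | (k <= i)%N].

Definition rk (b : 'I_n * 'I_n) : nat :=
  #|[set k : 'I_n | (k <= b.1)%N && (w k <= b.2)%N]|.

Definition diagram : {set 'I_n * 'I_n} :=
  [set b : 'I_n * 'I_n | (b.2 < w b.1)%N && (b.1 < (w^-1)%g b.2)%N].

(* A neighbour lying outside of the grid is not in the diagram. *)
Definition essential : {set 'I_n * 'I_n} :=
  [set b in diagram |
     [forall i : 'I_n, (i == b.1.+1 :> nat) ==> ((i, b.2) \notin diagram)] &&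
     [forall j : 'I_n, (j == b.2.+1 :> nat) ==> ((b.1, j) \notin diagram)]].

Implicit Types (I J : {set 'I_n}) (b : 'I_n * 'I_n).

Definition belongs I J b : bool :=
  [&& I \subset initial b.1, J \subset initial b.2,
      #|I| == (rk b).+1 & #|J| == (rk b).+1].

(* The minor (I, J), belonging to b, attends the northwest submatrix at b'. *)
Definition attends I J b b' : bool :=
  ((rk b' < #|I :&: initial b'.1|)%N && (#|J :&: initial b'.2| == (rk b).+1))
  || ((#|I :&: initial b'.1| == (rk b).+1) && (rk b' < #|J :&: initial b'.2|)%N).

Definition elusive I J : Prop :=
  exists b, [/\ b \in essential, belongs I J b &
    forall b', b' \in essential -> (rk b' < rk b)%N -> ~~ attends I J b b'].

(* Only meaningful for nonempty I and J, since an empty max is 0. *)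
Definition southeast_corner I J : nat * nat :=
  (\max_(i in I) (i : nat), \max_(j in J) (j : nat))%N.
End Permutation.

Section Minors.
Variables (K : fieldType) (n : nat).

Definition generic_mx : 'M[{mpoly K[n * n]}]_n :=
  \matrix_(i < n, j < n) 'X_(mxvec_index i j).

(* conform_mx casts the #|I| x #|J| submatrix to a square one when
   #|I| = #|J|; the value is junk otherwise. The rows and columns come in
   increasing order because enum_val enumerates 'I_n in increasing order. *)
Definition minor (I J : {set 'I_n}) : {mpoly K[n * n]} :=
  \det (conform_mx (0 : 'M_#|I|)
          (mxsub (@enum_val _ (mem I)) (@enum_val _ (mem J)) generic_mx)).

Variable w : 'S_n.

Definition determinantal_minor (p : {mpoly K[n * n]}) : Prop :=
  exists (b : 'I_n * 'I_n) (I J : {set 'I_n}),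
    belongs w I J b /\ p = minor I J.

Definition schubert_ideal : {mpoly K[n * n]} -> Prop :=
  ideal_gen determinantal_minor.

Definition elusive_minor (p : {mpoly K[n * n]}) : Prop :=
  exists I J : {set 'I_n}, elusive w I J /\ p = minor I J.
End Minors.

(* Main.v *)
Require Import Defs.
From HB Require Import structures.
From mathcomp Require Import all_boot all_order all_algebra all_fingroup.
From mathcomp Require Import mpoly zify.

Set Implicit Arguments.
Unset Strict Implicit.
Unset Printing Implicit Defensive.

(** Let d = |I| = |J|. Write s and t for the numbers of elements of I among the
    first p rows and of J among the first q columns, and r for the number of
    dots of w in the northwest p x q block. The inequality s + t > r + d,
    called excess below, controls the whole proof. An s x t block of rank at
    most r in a d x d matrix forces a vanishing determinant as soon as
    s + t > r + d; conversely, in the antidiagonal d x d matrix the northwest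
    s x t block has rank only max(0, s + t - d).

    Generation ([excessive_ideal]). A minor with excess at some position lies
    in the ideal of the elusive minors, by induction on d. The excess can be
    transported to an essential box: at a box outside the diagram, deleting the
    row or the column that contains a dot lowers r by 1 and s + t by at most 1;
    inside the diagram, moving southeast keeps r and does not lower s + t. If
    the minor is not elusive, the essential box can moreover be taken such that
    the minor does not belong to it, because attending a box is a special case
    of excess there. Then one Laplace expansion gives smaller minors that still
    have excess at that box. Every minor belonging to a box has
    s = t = d = r + 1, so all the determinantal generators are covered.

    Minimality ([elusive_minor_not_generated]). An elusive minor has no excess
    at any essential box of smaller rank ([elusive_not_excessive]). Let the
    elusive minor (I, J) belong to b, with d = rk b + 1, and let Z be the matrix that is zero outside I x J and antidiagonal on I x J. The minor
    (I, J) is 1 or -1 at Z. If another elusive minor, belonging to a box e, is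
    nonzero at Z, then its rows lie in I and its columns in J, and its size
    rk e + 1 is at most s + t - d at e; that is an excess at e. So rk e is not
    smaller than rk b, this minor has size at least d, and it is (I, J) itself.
    Hence evaluation at Z separates (I, J) from all the other elusive minors.

    Corners ([exists_elusive]). For a box (i, j) of the diagram, take for I the
    row i and the rows of the dots northwest of (i, j), and for J the column j
    and the columns of these dots. In a block of smaller rank that reaches
    column j, the rows of I are rows of dots counted by its rank; the same holds
    for the columns of J if the block reaches row i. This excludes attending. *)

(** * Counting the elements of a set of indices below a bound *)

Section Counting.
Variable n : nat.
Implicit Types (A B : {set 'I_n}) (k : 'I_n).

(** The bound is a natural number, and not an index, so that the empty block
    p = 0 is available as the base of inductions. *)
Definition below A (p : nat) : nat := #|[set k in A | k < p]|.

Lemma below_initial A k : #|A :&: initial k| = below A k.+1.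
Proof. by apply: eq_card => x; rewrite !inE. Qed.

Lemma initialS k k' : k <= k' -> initial k \subset initial k'.
Proof. by move=> le; apply/subsetP=> x; rewrite !inE => /leq_trans->. Qed.

Lemma below0 A : below A 0 = 0.
Proof. by apply: eq_card0 => x; rewrite !inE ltn0 andbF. Qed.

Lemma belowS A k : below A k.+1 = below A k + (k \in A).
Proof.
rewrite /below (cardsD1 k) inE ltnS leqnn andbT addnC; congr (_ + _).
apply: eq_card => x; rewrite !inE ltnS (ltn_neqAle x k) -val_eqE.
by case: (x \in A); rewrite ?andbF.
Qed.

Lemma below_le_card A p : below A p <= #|A|.
Proof. by apply/subset_leq_card/subsetP => x; rewrite inE => /andP[]. Qed.

Lemma leq_below A p q : p <= q -> below A p <= below A q.
Proof.
move=> lepq; apply/subset_leq_card/subsetP => x; rewrite !inE.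
by case/andP=> -> /leq_trans->.
Qed.

Lemma below_full A k : (below A k.+1 == #|A|) = (A \subset initial k).
Proof.
rewrite -below_initial; apply/eqP/setIidPl => [eqA | -> //].
by apply/eqP; rewrite eqEcard subsetIl eqA leqnn.
Qed.

Lemma below_setD A B p : B \subset A -> below A p = below B p + below (A :\: B) p.
Proof.
move=> sBA; rewrite /below -(cardsID B); congr (_ + _).
  apply: eq_card => x; rewrite !inE.
  by case: (boolP (x \in B)) => [/(subsetP sBA)->|]; rewrite ?andbF ?andbT.
by apply: eq_card => x; rewrite !inE andbA.
Qed.

Lemma below_lt A x y : x \in A -> x < y -> below A x < below A y.
Proof.
by move=> Ax ltxy; have := leq_below A ltxy; rewrite belowS Ax addn1.
Qed.

(** [below A] numbers the elements of A increasingly from 0; this gives the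
    positions of rows and columns without an explicit enumeration. *)
Lemma below_inj A x y : x \in A -> y \in A -> below A x = below A y -> x = y.
Proof.
move=> Ax Ay eqxy; have [lt|lt|/val_inj//] := ltngtP x y.
  by have := below_lt Ax lt; rewrite eqxy ltnn.
by have := below_lt Ay lt; rewrite eqxy ltnn.
Qed.

Lemma below_card_lt A k : k \in A -> below A k < #|A|.
Proof.
by move=> Ak; have := below_le_card A k.+1; rewrite belowS Ak addn1.
Qed.

End Counting.

(** * Ranks of northwest blocks, excess and elusive minors *)

Section Rank.
Local Open Scope group_scope.
Local Open Scope nat_scope.
Variable n : nat.
Implicit Types (w : 'S_n) (b e : 'I_n * 'I_n) (I J : {set 'I_n}).

Definition rank_below w (p q : nat) : nat := below [set k | w k < q] p.

Lemma rk_rank_below w b : rk w b = rank_below w b.1.+1 b.2.+1.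
Proof. by apply: eq_card => k; rewrite !inE !ltnS andbC. Qed.

(** Transposing the permutation matrix exchanges the roles of rows and columns;
    statements about columns are deduced in this way from those about rows. *)
Lemma rank_belowV w p q : rank_below w^-1 q p = rank_below w p q.
Proof.
rewrite /rank_below /below -[LHS](card_imset _ (@perm_inj _ w^-1)).
apply: eq_card => k; rewrite !inE; apply/imsetP/andP.
  by case=> x; rewrite !inE => /andP[xp xq] ->; rewrite permKV.
by case=> wk kp; exists (w k); rewrite ?inE permK ?kp ?wk.
Qed.

Lemma rank_below_rowS w (i : 'I_n) q :
  rank_below w i.+1 q = rank_below w i q + (w i < q).
Proof. by rewrite /rank_below belowS inE. Qed.

Lemma rank_below_colS w p (j : 'I_n) :
  rank_below w p j.+1 = rank_below w p j + (w^-1 j < p).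
Proof. by rewrite -!(rank_belowV w) rank_below_rowS. Qed.

Lemma leq_rank_below w p p' q q' :
  p' <= p -> q' <= q -> rank_below w p' q' <= rank_below w p q.
Proof.
move=> lep leq; apply/subset_leq_card/subsetP => k; rewrite !inE.
by case/andP=> /leq_trans-> // /leq_trans->.
Qed.

(** The defect is the number of dots in the southeast rectangle of rows p' to p
    and columns q' to q. *)
Lemma rank_below_supermodular w p p' q q' : p' <= p -> q' <= q ->
  rank_below w p' q + rank_below w p q' <= rank_below w p q + rank_below w p' q'.
Proof.
move=> lep leq; have sub : [set k | w k < q'] \subset [set k | w k < q].
  by apply/subsetP=> k; rewrite !inE => /leq_trans->.
rewrite /rank_below !(below_setD _ sub).
have := leq_below ([set k | w k < q] :\: [set k | w k < q']) lep.
lia.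
Qed.

Lemma diagramV w i j : ((j, i) \in diagram w^-1) = ((i, j) \in diagram w).
Proof. by rewrite !inE invgK /= andbC. Qed.

Lemma essentialV w i j : ((j, i) \in essential w^-1) = ((i, j) \in essential w).
Proof.
rewrite !(inE, in_set) /= invgK [X in X && _ = _]andbC; congr (_ && _).
by rewrite andbC; congr (_ && _); apply: eq_forallb => k;
  rewrite !inE /= invgK [X in ~~ X]andbC.
Qed.

Lemma rkV w i j : rk w^-1 (j, i) = rk w (i, j).
Proof. by rewrite !rk_rank_below rank_belowV. Qed.

Lemma attendsV w I J i j i' j' :
  attends w^-1 J I (j, i) (j', i') = attends w I J (i, j) (i', j').
Proof. by rewrite /attends !rkV /= orbC; congr (_ || _); rewrite andbC. Qed.

Lemma belongsV w I J i j : belongs w^-1 J I (j, i) = belongs w I J (i, j).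
Proof. by rewrite /belongs rkV /= andbCA [X in _ && (_ && X)]andbC. Qed.

(** Between two neighbouring boxes of the diagram the rank does not change, as
    the row or column that is added has its dot further out. *)
Lemma diagram_essential w b : b \in diagram w ->
  exists e, [/\ e \in essential w, b.1 <= e.1, b.2 <= e.2 & rk w e = rk w b].
Proof.
have [m] := ubnP ((n - b.1) + (n - b.2)).
elim: m b => // m IHm [i j] /= ltm Db.
have [Eb | ] := boolP ((i, j) \in essential w); first by exists (i, j).
have [lti ltj] := (ltn_ord i, ltn_ord j).
rewrite inE Db andTb negb_and => /orP[] /forallPn[/= k]; rewrite negb_imply negbK.
  case/andP=> /eqP kE Dk.
  have [||e [Ee le1 le2 rke]] := IHm (k, j) => //=; first by lia.
  exists e; split=> //; first by move: le1; rewrite /= kE => /ltnW.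
  rewrite rke !rk_rank_below /= rank_below_rowS kE.
  by move: Dk; rewrite inE /= => /andP[lt _]; rewrite ltnS leqNgt lt addn0.
case/andP=> /eqP kE Dk.
have [||e [Ee le1 le2 rke]] := IHm (i, k) => //=; first by lia.
exists e; split=> //; first by move: le2; rewrite /= kE => /ltnW.
rewrite rke !rk_rank_below /= rank_below_colS kE.
by move: Dk; rewrite inE /= => /andP[_ lt]; rewrite ltnS leqNgt lt addn0.
Qed.

(** For a minor of size d this says that the block of its rows above p and its
    columns left of q is too large to have rank [rank_below w p q] in a
    nonsingular d x d matrix. *)
Definition excessive w I J (p q : nat) : Prop :=
  rank_below w p q + #|I| < below I p + below J q.

(** Outside of the diagram, the last row or the last column of the block contains
    one of the dots of the block. Removing it lowers the rank by 1 and the count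
    of rows or columns of the minor by at most 1, so the excess persists. The
    process stops because an empty block has no excess. *)
Lemma excessive_diagram w I J p q : #|J| = #|I| -> p <= n -> q <= n ->
  excessive w I J p q ->
  exists2 b, b \in diagram w & excessive w I J b.1.+1 b.2.+1.
Proof.
rewrite /excessive => cardJ; have [m] := ubnP (p + q).
elim: m p q => // m IHm [|i] [|j] ltm lep leq exc.
- by move: exc; rewrite !below0; lia.
- by have := below_le_card J j.+1; move: exc; rewrite below0; lia.
- by have := below_le_card I i.+1; move: exc; rewrite below0; lia.
pose x := Ordinal lep; pose y := Ordinal leq.
have [D | ] := boolP ((x, y) \in diagram w); first by exists (x, y).
rewrite inE negb_and /= -!leqNgt => /orP[wx | wy].
  apply: (IHm i j.+1); [lia | lia | lia | move: exc].
  by rewrite (rank_below_rowS w x) (belowS I x) ltnS wx /=; case: (_ \in _); lia.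
apply: (IHm i.+1 j); [lia | lia | lia | move: exc].
by rewrite (rank_below_colS w _ y) (belowS J y) ltnS wy /=; case: (_ \in _); lia.
Qed.

Lemma excessive_essential w I J p q : #|J| = #|I| -> p <= n -> q <= n ->
  excessive w I J p q ->
  exists2 e, e \in essential w & excessive w I J e.1.+1 e.2.+1.
Proof.
move=> cardJ lep leq /(excessive_diagram cardJ lep leq)[b Db exc].
have [e [Ee le1 le2 rke]] := diagram_essential Db; exists e => //.
move: exc; rewrite /excessive -!rk_rank_below rke.
by move=> exc; apply: leq_trans exc _; apply: leq_add; apply: leq_below.
Qed.

(** A version of [excessive_diagram] that stays in the column of b: no dot of
    this column lies above the box, so a row whose box is outside of the diagram
    has its dot to the left and can be removed. *)
Lemma climb_diagram w I b p : b \in diagram w -> p <= b.1.+1 ->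
  rank_below w p b.2.+1 < below I p ->
  exists i : 'I_n, [/\ i < p, (i, b.2) \in diagram w &
                rank_below w i.+1 b.2.+1 < below I i.+1].
Proof.
rewrite inE => /andP[_ wb2]; elim: p => [|p IHp] lep; first by rewrite below0.
pose x := Ordinal (leq_trans lep (ltn_ord b.1)).
have [wx | wx] := ltnP b.2 (w x).
  by exists x; split=> //; rewrite inE wx (leq_ltn_trans _ wb2).
rewrite (rank_below_rowS w x) (belowS I x) ltnS wx /= => exc.
have [|i [lti Di exci]] := IHp (ltnW lep); first by move: exc; case: (_ \in _); lia.
by exists i; split=> //; lia.
Qed.

Lemma attendsE w I J b b' : belongs w I J b ->
  attends w I J b b' =
    (rk w b' < below I b'.1.+1) && (J \subset initial b'.2)
    || (I \subset initial b'.1) && (rk w b' < below J b'.2.+1).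
Proof.
case/and4P=> _ _ /eqP cI /eqP cJ.
by rewrite /attends !below_initial -{1}cJ -cI !below_full.
Qed.

Lemma attends_excessive w I J b b' : belongs w I J b -> attends w I J b b' ->
  excessive w I J b'.1.+1 b'.2.+1.
Proof.
move=> bel; rewrite attendsE // -!below_full /excessive -rk_rank_below.
case/and4P: bel => _ _ /eqP cI /eqP cJ.
by case/orP=> /andP[]; [move=> ? /eqP | move=> /eqP]; lia.
Qed.

(** This drives the induction for generation: either the minor is a generator, or
    there is an excess at a box to which it does not belong, and then some row
    or column of the minor is dispensable. *)
Lemma elusive_or_smaller_excess w I J e : e \in essential w ->
  excessive w I J e.1.+1 e.2.+1 ->
  elusive w I J \/ exists b, [/\ b \in essential w,
    excessive w I J b.1.+1 b.2.+1 & ~~ belongs w I J b].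
Proof.
move=> Ee exc; have [bel | nbel] := boolP (belongs w I J e); last by right; exists e.
have [/existsP[b /and3P[Eb lt att]] | /existsPn none] :=
  boolP [exists b, [&& b \in essential w, rk w b < rk w e & attends w I J e b]].
  right; exists b; split=> //; first exact: attends_excessive bel att.
  apply: contraL lt => /and4P[_ _ cIb _]; case/and4P: bel => _ _ cIe _.
  by move: cIb; rewrite (eqP cIe) eqSS -leqNgt => /eqP->.
left; exists e; split=> // b Eb lt; apply: contra (none b) => att.
by rewrite Eb lt.
Qed.

(** An excess in the full-width block above the box b can be moved up within the
    column of b into the diagram, then southeast to an essential box; all of J
    stays inside, so the minor attends that box. *)
Lemma attends_row_excess w I J b p : b \in essential w -> belongs w I J b ->
  p <= b.1.+1 -> rank_below w p b.2.+1 < below I p -> below I p < #|I| ->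
  exists b', [/\ b' \in essential w, rk w b' < rk w b & attends w I J b b'].
Proof.
rewrite inE => /andP[Db _] bel lep exc ltI.
have [i [lti Di exci]] := climb_diagram Db lep exc.
have [e [Ee le1 le2 rke]] := diagram_essential Di; exists e.
rewrite attendsE //; case/and4P: bel => _ sJ /eqP cI _; split=> //.
  rewrite rke rk_rank_below /=; have := leq_below I lti; lia.
rewrite rke rk_rank_below /= (leq_trans exci) ?leq_below //=.
by rewrite (subset_trans sJ) ?initialS.
Qed.

Lemma attends_col_excess w I J b q : b \in essential w -> belongs w I J b ->
  q <= b.2.+1 -> rank_below w b.1.+1 q < below J q -> below J q < #|J| ->
  exists b', [/\ b' \in essential w, rk w b' < rk w b & attends w I J b b'].
Proof.
case: b => i j; rewrite -essentialV -belongsV -rank_belowV => Eb bel leq exc ltJ.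
have [[j' i'] []] := attends_row_excess Eb bel leq exc ltJ.
by rewrite essentialV !rkV attendsV => *; exists (i', j').
Qed.

(** If the minor had excess at e, supermodularity applied to b and e would give
    an excess at (e.1, b.2) or at (b.1, e.2), where all columns or all rows of
    the minor are counted; such an excess makes the minor attend a box. *)
Lemma elusive_not_excessive w I J b e : b \in essential w -> belongs w I J b ->
  (forall b', b' \in essential w -> rk w b' < rk w b -> ~~ attends w I J b b') ->
  e \in essential w -> rk w e < rk w b -> ~ excessive w I J e.1.+1 e.2.+1.
Proof.
move=> Eb bel elu Ee lte; rewrite /excessive -rk_rank_below => exc.
have := elu _ Ee lte; rewrite attendsE // -!below_full.
have/and4P[sI sJ /eqP cI /eqP cJ] := bel.
rewrite negb_or !negb_and.
have leI := below_le_card I e.1.+1; have leJ := below_le_card J e.2.+1.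
case/andP=> natt1 natt2.
have {natt1} ltJ : below J e.2.+1 < #|J|.
  by case/orP: natt1 => [|/eqP]; lia.
have {natt2} ltI : below I e.1.+1 < #|I|.
  by case/orP: natt2 => [/eqP|]; lia.
(* As I and J stick out of the block at e, this block is strictly smaller than
   the one at b in both directions. *)
have [|le1] := leqP b.1.+1 e.1.+1.
  move/(leq_below I) => le; move: sI; rewrite -below_full => /eqP; lia.
have [|le2] := leqP b.2.+1 e.2.+1.
  move/(leq_below J) => le; move: sJ; rewrite -below_full => /eqP; lia.
have := rank_below_supermodular w (ltnW le1) (ltnW le2).
rewrite -!rk_rank_below => super.
have [excI | excI] := ltnP (rank_below w e.1.+1 b.2.+1) (below I e.1.+1).
  have [b' [Eb' ltb' att]] := attends_row_excess Eb bel (ltnW le1) excI ltI.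
  by have := elu _ Eb' ltb'; rewrite att.
have excJ : rank_below w b.1.+1 e.2.+1 < below J e.2.+1 by lia.
have [b' [Eb' ltb' att]] := attends_col_excess Eb bel (ltnW le2) excJ ltJ.
by have := elu _ Eb' ltb'; rewrite att.
Qed.

(** The rows of a minor with southeast corner b; the corresponding set of columns
    is [corner_rows w^-1 (b.2, b.1)]. *)
Definition corner_rows w b : {set 'I_n} :=
  b.1 |: [set k : 'I_n | (k <= b.1) && (w k <= b.2)].

Lemma card_corner_rows w b : b \in diagram w -> #|corner_rows w b| = (rk w b).+1.
Proof. by rewrite inE => /andP[lt _]; rewrite cardsU1 inE leqnn leqNgt lt. Qed.

Lemma corner_rows_initial w b : corner_rows w b \subset initial b.1.
Proof. by apply/subsetP=> k; rewrite !inE => /orP[/eqP->|/andP[]]. Qed.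

Lemma max_corner_rows w b : \max_(i in corner_rows w b) (i : nat) = b.1.
Proof.
apply/eqP; rewrite eqn_leq; apply/andP; split.
  by apply/bigmax_leqP => k /(subsetP (corner_rows_initial w b)); rewrite inE.
by apply: (@leq_bigmax_cond _ _ (fun i : 'I_n => i : nat)); rewrite setU11.
Qed.

Lemma below_corner_rows w b p : p <= b.1 ->
  below (corner_rows w b) p <= rank_below w p b.2.+1.
Proof.
move=> lep; apply/subset_leq_card/subsetP => k; rewrite !inE ltnS.
by case/andP=> /orP[/eqP->|/andP[_ ->]] lt //; move: lep; rewrite leqNgt lt.
Qed.

(** The rank condition forces e above b, where only rows of dots are counted,
    and the dots of these rows lie in the block of e. *)
Lemma corner_rows_within w b e : b.2 <= e.2 -> rk w e < rk w b ->
  below (corner_rows w b) e.1.+1 <= rk w e.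
Proof.
rewrite !rk_rank_below => le2 lt; have [le1 | lt1] := leqP b.1 e.1.
  by move: lt; rewrite ltnNge leq_rank_below.
by apply: leq_trans (below_corner_rows w lt1) _; apply: leq_rank_below.
Qed.

Lemma exists_elusive w b : b \in diagram w ->
  exists I J, elusive w I J /\ southeast_corner I J = (b.1 : nat, b.2 : nat).
Proof.
case: b => i j Db; have DbV : (j, i) \in diagram w^-1 by rewrite diagramV.
pose I := corner_rows w (i, j); pose J := corner_rows w^-1 (j, i).
have [[i' j'] [Ee /= lei lej rke]] := diagram_essential Db.
have bel : belongs w I J (i', j').
  rewrite /belongs rke /I /J !card_corner_rows // rkV !eqxx !andbT /=.
  by rewrite !(subset_trans (corner_rows_initial _ _)) ?initialS.
exists I, J; split; last by rewrite /southeast_corner !max_corner_rows.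
exists (i', j'); split=> // -[p q] Epq; rewrite rke => lt.
have corner_le v (c d k : 'I_n) : corner_rows v (c, d) \subset initial k -> c <= k.
  by move/subsetP/(_ c); rewrite setU11 inE => ->.
rewrite attendsE //= negb_or !negb_and -!leqNgt; apply/andP; split.
  have [/corner_le jq | _] := boolP (J \subset _); rewrite /= ?orbT // orbF.
  exact: (corner_rows_within (b := (i, j)) (e := (p, q))).
have [/corner_le ip | //] := boolP (I \subset _); rewrite /=.
by have := @corner_rows_within w^-1 (j, i) (q, p); rewrite !rkV; apply.
Qed.
End Rank.

(** * Ideals generated by a set *)

Section Ideal.
Import GRing.Theory.
Local Open Scope ring_scope.
Variable A : comNzRingType.
Implicit Types (G H : A -> Prop) (p q : A).

Lemma ideal_gen_mem G p : G p -> ideal_gen G p.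
Proof.
move=> Gp; exists [:: (1, p)]; last by rewrite big_seq1 mul1r.
by move=> c; rewrite inE => /eqP->.
Qed.

Lemma ideal_gen0 G : ideal_gen G 0.
Proof. by exists [::]; rewrite ?big_nil. Qed.

Lemma ideal_genD G p q : ideal_gen G p -> ideal_gen G q -> ideal_gen G (p + q).
Proof.
move=> [s Gs ->] [t Gt ->]; exists (s ++ t); last by rewrite big_cat.
by move=> c; rewrite mem_cat => /orP[/Gs|/Gt].
Qed.

Lemma ideal_genM G a p : ideal_gen G p -> ideal_gen G (a * p).
Proof.
move=> [s Gs ->]; exists [seq (a * c.1, c.2) | c <- s].
  by move=> c /mapP[d /Gs Gd ->].
by rewrite big_map mulr_sumr; apply: eq_bigr => c _; rewrite mulrA.
Qed.

Lemma ideal_gen_sum G (T : eqType) (s : seq T) (F : T -> A) :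
  (forall x, x \in s -> ideal_gen G (F x)) -> ideal_gen G (\sum_(x <- s) F x).
Proof.
move=> GF; rewrite big_seq; elim/big_ind: _ => //; first exact: ideal_gen0.
exact: ideal_genD.
Qed.

Lemma ideal_gen_trans G H p :
  (forall q, G q -> ideal_gen H q) -> ideal_gen G p -> ideal_gen H p.
Proof.
move=> GH [s Gs ->]; apply: ideal_gen_sum => c /Gs/GH; exact: ideal_genM.
Qed.

(** The tool for non-membership: the kernel of a ring morphism is an ideal. *)
Lemma ideal_gen_ker (B : comNzRingType) (f : {rmorphism A -> B}) G p :
  (forall q, G q -> f q = 0) -> ideal_gen G p -> f p = 0.
Proof.
move=> Gf [s Gs ->]; rewrite rmorph_sum big_seq big1 // => c /Gs/Gf fc.
by rewrite rmorphM fc mulr0.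
Qed.
End Ideal.

(** * Minors with excess lie in the ideal of the elusive minors *)

Section Minor.
Import GRing.Theory.
Local Open Scope ring_scope.
Variables (K : fieldType) (n : nat).
Implicit Types (I J : {set 'I_n}) (w : 'S_n).

Local Notation M := (generic_mx K n).

(** The size is a parameter [d] that is only provably equal to #|I|, so that row
    and column enumerations share it and the submatrix is square. *)
Definition enum_of I d (cI : #|I| = d) (i : 'I_d) : 'I_n :=
  enum_val (cast_ord (esym cI) i).

Lemma enum_of_inj I d (cI : #|I| = d) : injective (enum_of cI).
Proof. exact: inj_comp enum_val_inj (@cast_ord_inj _ _ _). Qed.

Lemma mem_enum_of I d (cI : #|I| = d) i : enum_of cI i \in I.
Proof. exact: enum_valP. Qed.

Lemma enum_of_imset I d (cI : #|I| = d) : enum_of cI @: [set: 'I_d] = I.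
Proof.
apply/eqP; rewrite eqEcard card_imset; last exact: enum_of_inj.
rewrite cardsT card_ord cI leqnn andbT.
by apply/subsetP=> _ /imsetP[i _ ->]; apply: mem_enum_of.
Qed.

Lemma minorE I J d (cI : #|I| = d) (cJ : #|J| = d) :
  minor K I J = \det (mxsub (enum_of cI) (enum_of cJ) M).
Proof.
subst d; rewrite /minor; congr (\det _).
have conf k (e : k = #|I|) (h : 'I_k -> 'I_n) :
    conform_mx (0 : 'M_#|I|) (mxsub (@enum_val _ (mem I)) h M) =
    mxsub (@enum_val _ (mem I)) (fun j => h (cast_ord (esym e) j)) M.
  subst k; rewrite conform_mx_id; apply/matrixP => i j.
  by rewrite !mxE /= cast_ord_id.
rewrite (conf _ cJ); apply/matrixP => i j.
by rewrite !mxE /enum_of cast_ord_id.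
Qed.

Lemma injective_reindex d (f g : 'I_d -> 'I_n) : injective f ->
  f @: [set: 'I_d] = g @: [set: 'I_d] -> exists s : 'S_d, forall i, f i = g (s i).
Proof.
move=> injf eq_im.
have /fin_all_exists[s sE] i : exists j, f i == g j.
  have : f i \in g @: [set: 'I_d] by rewrite -eq_im imset_f.
  by case/imsetP=> j _ ->; exists j.
have injs : injective s.
  by move=> i j eqs; apply: injf; rewrite (eqP (sE i)) (eqP (sE j)) eqs.
by exists (perm injs) => i; rewrite permE (eqP (sE i)).
Qed.

(** Laplace expansion produces submatrices indexed by arbitrary injections; they
    differ from the increasing ones by permutations, that is by a sign, which is
    harmless for ideal membership. *)
Lemma det_mxsub_minor d (f g : 'I_d -> 'I_n) : injective f -> injective g ->
  exists b : bool,
    \det (mxsub f g M) = (-1) ^+ b * minor K (f @: [set: 'I_d]) (g @: [set: 'I_d]).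
Proof.
move=> injf injg; set I := f @: _; set J := g @: _.
have cI : #|I| = d by rewrite card_imset // cardsT card_ord.
have cJ : #|J| = d by rewrite card_imset // cardsT card_ord.
rewrite (minorE cI cJ).
have [s sE] := injective_reindex injf (esym (enum_of_imset cI)).
have [t tE] := injective_reindex injg (esym (enum_of_imset cJ)).
have -> : mxsub f g M = row_perm s (col_perm t (mxsub (enum_of cI) (enum_of cJ) M)).
  by apply/matrixP=> i j; rewrite !mxE sE tE.
exists (s (+) t); rewrite row_permE col_permE !det_mulmx !det_perm signr_addb.
by rewrite odd_permV -mulrA [X in _ * X]mulrC.
Qed.

Lemma below_imset_lift d (f : 'I_d.+1 -> 'I_n) (i : 'I_d.+1) p : injective f ->
  below (f @: [set: 'I_d.+1]) p
    = (below ((f \o lift i) @: [set: 'I_d]) p + (f i < p))%N.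
Proof.
move=> injf; rewrite /below (cardsD1 (f i)) inE imset_f // addnC; congr (_ + _)%N.
apply: eq_card => x; rewrite !inE; apply/and3P/andP.
  case=> nx /imsetP[k _ xE] xp; split=> //; apply/imsetP.
  case: (unliftP i k) xE => [k' ->|->] xE; first by exists k'.
  by rewrite xE eqxx in nx.
case=> /imsetP[k _ ->] lt; split=> //=; last exact: imset_f.
by rewrite (inj_eq injf) eq_sym neq_lift.
Qed.

(** Expanding along a line lowers the size by 1. If the line lies outside of the
    block at b, it does not count in the block, while each perpendicular line
    counts for at most 1, so the excess persists. If all rows and columns of the
    minor lie in the block, the excess says that the size exceeds the rank, and
    it persists unless the size is the rank plus 1, the case in which the minor
    belongs to b. *)
Lemma excessive_ideal w d (f g : 'I_d -> 'I_n) p q : injective f -> injective g ->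
  (p <= n)%N -> (q <= n)%N ->
  excessive w (f @: [set: 'I_d]) (g @: [set: 'I_d]) p q ->
  ideal_gen (@elusive_minor K n w) (\det (mxsub f g M)).
Proof.
elim: d f g p q => [|d IHd] f g p q injf injg lep leq exc.
  have below_ord0 (h : 'I_0 -> 'I_n) r : below (h @: [set: 'I_0]) r = 0%N.
    apply/eqP; rewrite -leqn0 (leq_trans (below_le_card _ _)) //.
    by rewrite (leq_trans (leq_imset_card _ _)) // cardsT card_ord.
  by move: exc; rewrite /excessive !below_ord0.
set I := f @: _ in exc *; set J := g @: _ in exc *.
have cI : #|I| = d.+1 by rewrite card_imset // cardsT card_ord.
have cJ : #|J| = d.+1 by rewrite card_imset // cardsT card_ord.
have [e Ee exce] : exists2 e, e \in essential w & excessive w I J e.1.+1 e.2.+1.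
  by apply: excessive_essential lep leq exc; rewrite cI cJ.
have [elu | [b [Eb excb nbel]]] := elusive_or_smaller_excess Ee exce.
  have [b ->] := det_mxsub_minor injf injg; apply/ideal_genM/ideal_gen_mem.
  by exists I, J.
have lift_inj (h : 'I_d.+1 -> 'I_n) i : injective h -> injective (h \o lift i).
  by move=> injh; apply: inj_comp injh (@lift_inj _ i).
have card_lift (h : 'I_d.+1 -> 'I_n) i :
    injective h -> #|(h \o lift i) @: [set: 'I_d]| = d.
  by move=> injh; rewrite card_imset ?cardsT ?card_ord //; apply: lift_inj.
pose excess i j := excessive w ((f \o lift i) @: [set: 'I_d])
  ((g \o lift j) @: [set: 'I_d]) b.1.+1 b.2.+1.
have rec i j : excess i j ->
   ideal_gen (@elusive_minor K n w) (mxsub f g M i j * cofactor (mxsub f g M) i j).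
  move=> exc'; apply: ideal_genM; rewrite /cofactor; apply: ideal_genM.
  have -> : row' i (col' j (mxsub f g M)) = mxsub (f \o lift i) (g \o lift j) M.
    by apply/matrixP=> k l; rewrite !mxE.
  apply: IHd exc'; auto; exact: ltn_ord.
have bf i := below_imset_lift i b.1.+1 injf.
have bg j := below_imset_lift j b.2.+1 injg.
have [sI | /subsetPn[_ /imsetP[/= i _ ->]]] := boolP (I \subset initial b.1); last first.
  rewrite inE -ltnNge => lti; rewrite (expand_det_row _ i).
  have drop_row (j : 'I_d.+1) : excess i j.
    by move: excb; rewrite /excess /excessive cI card_lift // (bf i) (bg j); lia.
  by apply: ideal_gen_sum => j _; apply: rec.
have [sJ | /subsetPn[_ /imsetP[/= j _ ->]]] := boolP (J \subset initial b.2); last first.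
  rewrite inE -ltnNge => ltj; rewrite (expand_det_col _ j).
  have drop_col (i : 'I_d.+1) : excess i j.
    by move: excb; rewrite /excess /excessive cI card_lift // (bf i) (bg j); lia.
  by apply: ideal_gen_sum => i _; apply: rec.
rewrite (expand_det_row _ ord0).
have drop_any (j : 'I_d.+1) : excess ord0 j.
  move: nbel excb; rewrite /belongs sI sJ /= cI cJ andbb.
  move: sI sJ; rewrite -!below_full cI cJ => /eqP fI /eqP fJ /eqP nrk.
  rewrite /excess /excessive cI card_lift // -rk_rank_below.
  by move: (bf ord0) (bg j); rewrite fI fJ; lia.
by apply: ideal_gen_sum => j _; apply: rec.
Qed.
End Minor.

(** * Evaluation at an antidiagonal matrix *)

Section Minimality.
Import GRing.Theory.
Local Open Scope ring_scope.
Variables (K : fieldType) (n : nat).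
Implicit Types (I J : {set 'I_n}) (w : 'S_n).

Definition antidiagonal I J : 'M[K]_n :=
  \matrix_(x, y) [&& x \in I, y \in J & (below I x + below J y).+1 == #|I|]%:R.

Lemma det_antidiagonal I J d (cI : #|I| = d) (cJ : #|J| = d) :
  \det (mxsub (enum_of cI) (enum_of cJ) (antidiagonal I J)) != 0.
Proof.
have below_ltd (L : {set 'I_n}) (cL : #|L| = d) i : (below L (enum_of cL i) < d)%N.
  by rewrite -[ltnRHS]cL below_card_lt ?mem_enum_of.
pose pos (L : {set 'I_n}) (cL : #|L| = d) i := Ordinal (below_ltd L cL i).
have pos_inj (L : {set 'I_n}) (cL : #|L| = d) : injective (pos L cL).
  move=> i j /(congr1 val) /= eqij; apply: (enum_of_inj (cI := cL)).
  by apply: below_inj eqij; apply: mem_enum_of.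
(* Up to reordering rows and columns by position, the submatrix is the
   permutation matrix of the reversal. *)
pose s := (perm (pos_inj I cI) * perm rev_ord_inj * (perm (pos_inj J cJ))^-1)%g.
suff -> : mxsub (enum_of cI) (enum_of cJ) (antidiagonal I J) = perm_mx s.
  by rewrite det_perm signr_eq0.
apply/matrixP=> i j; rewrite !mxE !mem_enum_of /=; congr (_%:R); congr nat_of_bool.
rewrite !permM -(inj_eq (@perm_inj _ (perm (pos_inj J cJ)))) permKV !permE.
rewrite -val_eqE /= cI; have := below_ltd I cI i; lia.
Qed.

(** A nonzero term of the determinant pairs the rows of f with columns of g so
    that the position a in I and the position c in J satisfy a + c + 1 = #|I|.
    As a < below I p and c < below J q, the positions of the rows are distinct
    numbers from #|I| - below J q to below I p - 1. *)
Lemma det_antidiagonal_neq0 I J d (f g : 'I_d -> 'I_n) p q :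
  injective f -> (forall i, f i < p)%N -> (forall j, g j < q)%N -> #|J| = #|I| ->
  \det (mxsub f g (antidiagonal I J)) != 0 ->
  [/\ f @: [set: 'I_d] \subset I, g @: [set: 'I_d] \subset J &
      (d <= below I p + below J q - #|I|)%N].
Proof.
move=> injf ltf ltg cJ nz.
have [s sP] : exists s : 'S_d, forall i, antidiagonal I J (f i) (g (s i)) != 0.
  have [/existsP[s /forallP sP] | /existsPn none] :=
    boolP [exists s : 'S_d, [forall i, antidiagonal I J (f i) (g (s i)) != 0]].
    by exists s.
  case/eqP: nz; apply: big1 => s _; have /forallPn[/= i] := none s.
  by rewrite negbK => /eqP eq0; rewrite (bigD1 i) //= mxE eq0 mul0r mulr0.
have {}sP i : [/\ f i \in I, g (s i) \in J &
                 (below I (f i) + below J (g (s i))).+1 = #|I|].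
  have := sP i; rewrite mxE.
  by have [/and3P[-> -> /eqP->] | _] := boolP [&& _, _ & _]; last rewrite eqxx.
split; first by apply/subsetP=> _ /imsetP[i _ ->]; case: (sP i).
  by apply/subsetP=> _ /imsetP[i _ ->]; case: (sP (s^-1 i)%g); rewrite permKV.
have leJ := below_le_card J q.
have lower i : (#|I| - below J q <= below I (f i))%N.
  by case: (sP i) => _ gJ; have := below_lt gJ (ltg (s i)); lia.
have bound i : (below I (f i) - (#|I| - below J q) < below I p + below J q - #|I|)%N.
  case: (sP i) => fI gJ; have := below_lt fI (ltf i); have := below_lt gJ (ltg (s i)).
  lia.
have inj : injective (fun i => Ordinal (bound i)).
  move=> i j /(congr1 val) /= eqij; apply: injf.
  have [[fiI _ _] [fjI _ _]] := (sP i, sP j); apply: (below_inj fiI fjI).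
  by rewrite -(subnK (lower i)) eqij subnK.
by have := leq_card _ inj; rewrite !card_ord.
Qed.

Lemma eval_minor I J I' J' d (cI' : #|I'| = d) (cJ' : #|J'| = d) :
  meval (fun k => mxvec (antidiagonal I J) 0 k) (minor K I' J') =
  \det (mxsub (enum_of cI') (enum_of cJ') (antidiagonal I J)).
Proof.
rewrite (minorE _ cI' cJ') -det_map_mx; congr (\det _); apply/matrixP=> i j.
by rewrite !mxE /= mevalXU mxvecE !mxE.
Qed.

(** The other generators vanish at the antidiagonal matrix of (I, J): otherwise
    their size would exhibit an excess of (I, J) at a box of smaller rank. *)
Lemma elusive_minor_not_generated w I J : elusive w I J ->
  ~ ideal_gen (fun p => elusive_minor w p /\ p <> minor K I J) (minor K I J).
Proof.
case=> b [Eb bel elu]; have /and4P[_ _ /eqP cI /eqP cJ] := bel => gen.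
have /eqP := det_antidiagonal cI cJ; rewrite -eval_minor; apply.
apply: ideal_gen_ker gen => _ [[I' [J' [[e [Ee bel' _]] ->]]] neq].
have /and4P[sI' sJ' /eqP cI' /eqP cJ'] := bel'.
rewrite /= (eval_minor _ _ cI' cJ'); apply/eqP/negPn/negP.
have in_initial (L : {set 'I_n}) k d (cL : #|L| = d) i :
    L \subset initial k -> (enum_of cL i < k.+1)%N.
  by move/subsetP/(_ _ (mem_enum_of cL i)); rewrite inE.
case/(det_antidiagonal_neq0 (p := e.1.+1) (q := e.2.+1)).
- exact: enum_of_inj.
- by move=> i; apply: in_initial.
- by move=> j; apply: in_initial.
- by rewrite cI.
rewrite !enum_of_imset => sI sJ le.
have [lt | ge] := ltnP (rk w e) (rk w b).
  apply: (elusive_not_excessive Eb bel elu Ee lt).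
  by rewrite /excessive -rk_rank_below; lia.
(* Here the other minor is at least as large as (I, J), hence equal to it. *)
by case: neq; congr minor; apply/eqP;
  rewrite eqEcard ?sI ?sJ ?cI ?cJ ?cI' ?cJ' ltnS.
Qed.

Lemma elusive_minors_generate w :
  generates (@elusive_minor K n w) (@schubert_ideal K n w).
Proof.
move=> p; split; apply: ideal_gen_trans => q.
  by move=> [I [J [[b [_ bel _]] ->]]]; apply: ideal_gen_mem; exists b, I, J.
move=> [b [I [J [bel ->]]]]; have /and4P[sI sJ /eqP cI /eqP cJ] := bel.
rewrite (minorE _ cI cJ).
apply: (excessive_ideal K (p := b.1.+1) (q := b.2.+1)) => //; try exact: enum_of_inj.
rewrite !enum_of_imset /excessive -rk_rank_below.
by move: sI sJ; rewrite -!below_full => /eqP-> /eqP->; rewrite cI cJ; lia.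
Qed.
End Minimality.

Theorem theorem1p6 (K : fieldType) (n : nat) (hn : 1 <= n) (w : 'S_n) :
  minimally_generates (@elusive_minor K n w) (@schubert_ideal K n w) /\
  (forall b : 'I_n * 'I_n, b \in diagram w ->
     exists I J : {set 'I_n},
       elusive w I J /\ southeast_corner I J = (b.1 : nat, b.2 : nat)).
Proof.
split; last exact: exists_elusive.
split; first exact: elusive_minors_generate.
move=> S [sub [_ [[I [J [elu ->]]] nS]]] genS.
apply: (elusive_minor_not_generated (K := K) elu).
have /genS : schubert_ideal w (minor K I J).
  by apply/elusive_minors_generate/ideal_gen_mem; exists I, J.
apply: ideal_gen_trans => q Sq; apply: ideal_gen_mem; split; first exact: sub.
by move=> qE; apply: nS; rewrite -qE.
Qed.
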